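(* Assume that $(c_i)_{i\ge1}$ is nonnegative and nondecreasing and that $\sum_{i=1}^\infty c_iq^i<\infty$. Then for every $i\ge1$ the average-criterion marginal productivity index is $$m_{(1,i)}=\mu\Big[i\,p\,C_{i+1}(q)-\sum_{j=1}^ic_j\Big]=\begin{cases}\displaystyle\mu\Big[i\,p\sum_{j=1}^\infty q^{j-1}c_{i+j}-\sum_{j=1}^ic_j\Big]&\text{if }q>0,\\[2mm]\displaystyle i\,p\,c_{i+1}-\sum_{j=1}^ic_j&\text{if }q=0,\end{cases}$$ where $C_i(q)=\sum_{j=1}^\infty q^{j-1}c_{i-1+j}$ if $q>0$ and $C_i(0)=c_i$.
   Context: Single-user model. Fix $\lambda\in(0,1]$ (packet arrival probability), $\mu\in(0,1]$ (transmission success probability); put $p=\lambda\mu$, $q=1-p$. A controlled Markov chain $Y(t)=(B(t),X(t))$, $t=0,1,\dots$, lives on $\{0,1\}\times\{1,2,\dots\}$; $X(t)$ is the Age of Information, $B(t)=1$ iff a packet is available. Actions are $A(t)\in\{0,1\}$ ($1$ = attempt transmission). In states $(0,i)$ only action $0$ is available; in states $(1,i)$ both are. If $Y(t)=(b,i)$ and $A(t)=0$, then $X(t+1)=i+1$; if $Y(t)=(1,i)$ and $A(t)=1$, then $X(t+1)=1$ with probability $\mu$ and $i+1$ with probability $1-\mu$. In all cases $B(t+1)=1$ with probability $\lambda$ and $0$ otherwise, independently of $X(t+1)$. The cost in a slot with age $i$ is $c_i$. For $\beta\in(0,1)$, a policy $\pi$ and initial state $(b,i)$: $F_{\beta,(b,i)}^\pi=\mathbb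 E_{(b,i)}^\pi[\sum_{t\ge0}c_{X(t)}\beta^t]$, $G_{\beta,(b,i)}^\pi=\mathbb E_{(b,i)}^\pi[\sum_{t\ge0}A(t)\beta^t]$. For an integer $k\ge0$ the $k$-policy takes action $1$ in state $(1,j)$ iff $j>k$; $\langle a,k\rangle$ is the policy taking action $a$ at $t=0$ and following the $k$-policy from $t=1$ onward. For $i\ge1$: $f_{\beta,(1,i)}^k=F_{\beta,(1,i)}^{\langle0,k\rangle}-F_{\beta,(1,i)}^{\langle1,k\rangle}$, $g_{\beta,(1,i)}^k=G_{\beta,(1,i)}^{\langle1,k\rangle}-G_{\beta,(1,i)}^{\langle0,k\rangle}$. The average-criterion marginal metrics are $f_{(1,i)}^k=\lim_{\beta\uparrow1}f_{\beta,(1,i)}^k$, $g_{(1,i)}^k=\lim_{\beta\uparrow1}g_{\beta,(1,i)}^k$ (the latter is positive), and the average-criterion marginal productivity index is $m_{(1,i)}=f_{(1,i)}^i/g_{(1,i)}^i$. *)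

(* Defs.v *)
From HB Require Import structures.
From mathcomp Require Import all_boot all_order all_algebra.
From mathcomp Require Import all_classical all_reals all_analysis.

Set Implicit Arguments.
Unset Strict Implicit.
Unset Printing Implicit Defensive.

Import Order.TTheory GRing.Theory Num.Theory.
Import numFieldNormedType.Exports.

Local Open Scope classical_set_scope.
Local Open Scope ring_scope.

(* (b, i): b is the packet-availability bit B, i the age X. The age is a [nat]
   that is kept positive by [age_pos] below. Action [true] is "transmit". *)
Definition state := (bool * nat)%type.

(* History-dependent randomized policies: [pi h y] is the probability of
   transmitting in the current state [y] after the (chronological) list [h] of
   past state-action pairs. *)
Definition policy (R : realType) := seq (state * bool) -> state -> R.

Definition admissible (R : realType) (pi : policy R) : Prop :=
  forall h y, 0 <= pi h y <= 1 /\ (~~ y.1 -> pi h y = 0).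

Definition threshold_policy (R : realType) (k : nat) : policy R :=
  fun _ y => (y.1 && (k < y.2)%N)%:R.

(* <a, k>; as action 1 is unavailable in states (0, i), a = 1 is only effective
   when the initial bit is 1. *)
Definition then_threshold (R : realType) (a : bool) (k : nat) : policy R :=
  fun h y => if nilp h then (a && y.1)%:R else threshold_policy R k h y.

(* The case y.1 = false, a = true never occurs under an admissible policy. *)
Definition age_trans (R : realType) (mu : R) (y : state) (a : bool) (j : nat)
    : R :=
  if y.1 && a then mu * (j == 1%N)%:R + (1 - mu) * (j == y.2.+1)%:R
  else (j == y.2.+1)%:R.

Definition trans (R : realType) (lam mu : R) (y : state) (a : bool)
    (y' : state) : R :=
  (if y'.1 then lam else 1 - lam) * age_trans mu y a y'.2.

(* The controlled chain on a measurable space [T], with one probability measure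
   [Pr pi y] for each policy and initial state (the measure behind E_y^pi). The
   laws are the usual conditional ones given the whole past, written as products
   so that conditioning on null events imposes nothing. *)
Record controlled_chain (R : realType) (lam mu : R) (d : measure_display)
    (T : measurableType d) := ControlledChain {
  avail : nat -> {mfun T >-> bool} ;
  age : nat -> {mfun T >-> nat} ;
  action : nat -> {mfun T >-> bool} ;
  Pr : policy R -> state -> probability T R ;
  chain_state := fun (t : nat) (w : T) => (avail t w, age t w) : state ;
  history := fun (t : nat) (w : T) =>
    mkseq (fun s => (chain_state s w, action s w)) t ;
  age_pos : forall t w, (0 < age t w)%N ;
  initial_law : forall pi y, admissible pi -> (0 < y.2)%N ->
    Pr pi y [set w | chain_state 0%N w = y] = 1%E ;
  action_law : forall pi y t h z, admissible pi -> (0 < y.2)%N ->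
    (Pr pi y [set w | [/\ history t w = h, chain_state t w = z
                        & action t w = true]] =
     Pr pi y [set w | history t w = h /\ chain_state t w = z]
       * (pi h z)%:E)%E ;
  transition_law : forall pi y t h z a z', admissible pi -> (0 < y.2)%N ->
    (Pr pi y [set w | history t.+1 w = rcons h (z, a)
                      /\ chain_state t.+1 w = z'] =
     Pr pi y [set w | history t.+1 w = rcons h (z, a)]
       * (trans lam mu z a z')%:E)%E
}.

Definition discounted_cost (R : realType) (lam mu : R) (d : measure_display)
    (T : measurableType d) (Y : controlled_chain lam mu T) (c : nat -> R)
    (beta : R) (pi : policy R) (y : state) : \bar R :=
  (\int[Pr Y pi y]_w (\sum_(0 <= t <oo) (c (age Y t w) * beta ^+ t)%:E))%E.

Definition discounted_work (R : realType) (lam mu : R) (d : measure_display)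
    (T : measurableType d) (Y : controlled_chain lam mu T)
    (beta : R) (pi : policy R) (y : state) : \bar R :=
  (\int[Pr Y pi y]_w
     (\sum_(0 <= t <oo) ((action Y t w : nat)%:R * beta ^+ t)%:E))%E.

Definition marginal_cost_disc (R : realType) (lam mu : R) (d : measure_display)
    (T : measurableType d) (Y : controlled_chain lam mu T) (c : nat -> R)
    (k i : nat) (beta : R) : R :=
  fine (discounted_cost Y c beta (then_threshold R false k) (true, i))
  - fine (discounted_cost Y c beta (then_threshold R true k) (true, i)).

Definition marginal_work_disc (R : realType) (lam mu : R) (d : measure_display)
    (T : measurableType d) (Y : controlled_chain lam mu T)
    (k i : nat) (beta : R) : R :=
  fine (discounted_work Y beta (then_threshold R true k) (true, i))
  - fine (discounted_work Y beta (then_threshold R false k) (true, i)).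

Definition marginal_cost (R : realType) (lam mu : R) (d : measure_display)
    (T : measurableType d) (Y : controlled_chain lam mu T) (c : nat -> R)
    (k i : nat) : R :=
  lim (marginal_cost_disc Y c k i beta @[beta --> (1 : R)^'-]).

Definition marginal_work (R : realType) (lam mu : R) (d : measure_display)
    (T : measurableType d) (Y : controlled_chain lam mu T) (k i : nat) : R :=
  lim (marginal_work_disc Y k i beta @[beta --> (1 : R)^'-]).

Definition mp_index (R : realType) (lam mu : R) (d : measure_display)
    (T : measurableType d) (Y : controlled_chain lam mu T) (c : nat -> R)
    (i : nat) : R :=
  marginal_cost Y c i i / marginal_work Y i i.

(* The fine parts and limits above are junk-valued when the quantity does not
   exist; this says that everything entering [mp_index Y c i] does. *)
Definition mp_index_well_defined (R : realType) (lam mu : R)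
    (d : measure_display) (T : measurableType d)
    (Y : controlled_chain lam mu T) (c : nat -> R) (i : nat) : Prop :=
  [/\ forall (beta : R) (a : bool), 0 < beta < 1 ->
        discounted_cost Y c beta (then_threshold R a i) (true, i)
          \is a fin_num /\
        discounted_work Y beta (then_threshold R a i) (true, i)
          \is a fin_num,
      cvg (marginal_cost_disc Y c i i beta @[beta --> (1 : R)^'-]),
      cvg (marginal_work_disc Y i i beta @[beta --> (1 : R)^'-])
    & 0 < marginal_work Y i i].

Definition tail_cost (R : realType) (c : nat -> R) (i : nat) (x : R) : R :=
  if 0 < x then limn (fun n => \sum_(1 <= j < n) x ^+ j.-1 * c (i.-1 + j)%N)
  else c i.

(* Main.v *)
(* Only the first action distinguishes <0,k> from <1,k>, and the bit B is
   redrawn independently of the age. Averaging over B, the expected discounted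
   totals of the k-policy depend on the age alone and satisfy
     V(x) = r(x) + beta (p_x V(1) + (1 - p_x) V(x+1)),   p_x = p [k < x],
   with r = c for the cost and r(x) = lam [k < x] for the work. Hence
   f = beta mu (V(i+1) - V(1)) and g = 1 - beta mu (V(i+1) - V(1)). For k = i the
   recursion is solved explicitly: with N = sum_(j < i) beta^j, y = beta q,
   D = sum_j y^j r(i+1+j) and S = sum_(j < i) beta^j r(j+1),
     V(i+1) - V(1) = (N (1 - y) D - S) / (1 + beta p N),
   which tends to (i p D - S) / (1 + i p) as beta tends to 1; for the work D is
   lam / p and S = 0, so that g tends to 1 / (1 + i p). *)

Require Import Defs.
From HB Require Import structures.
From mathcomp Require Import all_boot all_order all_algebra.
From mathcomp Require Import all_classical all_reals all_analysis.
From mathcomp Require Import measurable_realfun ring lra.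
Import Order.TTheory GRing.Theory Num.Theory.
Import numFieldNormedType.Exports.
Local Open Scope classical_set_scope.
Local Open Scope ring_scope.

Set Implicit Arguments.
Unset Strict Implicit.
Unset Printing Implicit Defensive.

(** * Countable decompositions of events along a discrete random variable *)

(** Indexing fibres by codes in [nat] makes countable additivity applicable; a number that codes no
    element contributes an empty fibre. *)
Lemma pickle_fibre T (K : countType) (X : T -> K) n :
  (exists k, (pickle \o X) @^-1` [set n] = X @^-1` [set k]) \/
  (pickle \o X) @^-1` [set n] = set0.
Proof.
have [[k kn]|nk] := pselect (exists k : K, pickle k = n).
  left; exists k; apply/seteqP; split => w; rewrite -kn /=; last by move->.
  exact: (pcan_inj pickleK).
by right; rewrite -subset0 => w Fw; apply: nk; exists (X w).
Qed.

Lemma measurable_pickle_fibre d (T : measurableType d) (K : countType)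
    (X : T -> K) n :
  (forall k, measurable (X @^-1` [set k])) ->
  measurable ((pickle \o X) @^-1` [set n]).
Proof. by move=> mX; case: (pickle_fibre X n) => [[k]|] ->. Qed.

Lemma measurable_fibres d (T : measurableType d) (K : countType)
    (X : T -> K) (B : set K) :
  (forall k, measurable (X @^-1` [set k])) -> measurable (X @^-1` B).
Proof.
move=> mX; rewrite (_ : _ @^-1` _ =
    \bigcup_(n in pickle @` B) ((pickle \o X) @^-1` [set n])).
  by apply: bigcup_measurable => n _; exact: measurable_pickle_fibre.
apply/seteqP; split => [w Bw|w [n [k Bk <-] Xw]].
  by exists (pickle (X w)) => //; exists (X w).
by have kX : k = X w by [apply: (pcan_inj pickleK)]; rewrite /preimage /= -kX.
Qed.

(** Countable additivity sums the fibrewise identities. This is how laws conditional on the whole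
    past become laws conditional on the current state only. *)
Lemma measure_eq_fibres d (T : measurableType d) (R : realType)
    (m : probability T R) (K : countType) (X : T -> K)
    (A B : set T) (r : R) :
  measurable A -> measurable B ->
  (forall k, measurable (X @^-1` [set k])) ->
  (forall k, (m (A `&` X @^-1` [set k]) =
              r%:E * m (B `&` X @^-1` [set k]))%E) ->
  (m A = r%:E * m B)%E.
Proof.
move=> mA mB mX AB; pose F n := (pickle \o X) @^-1` [set n].
have mF n : measurable (F n) by exact: measurable_pickle_fibre.
have mE C : measurable C -> (m C = \sum_(n <oo) m (C `&` F n))%E.
  move=> mC; rewrite -measure_semi_bigcup//.
  - congr (m _); apply/seteqP; split => [w Cw|w [n _ []]//].
    by exists (pickle (X w)).
  - by move=> n; exact: measurableI.
  - apply/trivIsetP => n1 n2 _ _ /eqP n12; rewrite -subset0 => w [[_ Fn1] [_ Fn2]].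
    by apply: n12; rewrite -Fn1 -Fn2.
  - by apply: bigcupT_measurable => n; exact: measurableI.
rewrite (mE A)// (mE B)// -nneseriesZl//; apply: eq_eseriesr => n _.
rewrite /F; case: (pickle_fibre X n) => [[k]|] ->; first exact: AB.
by rewrite !setI0 measure0 mule0.
Qed.

Lemma measure0_fibres d (T : measurableType d) (R : realType)
    (m : probability T R) (K : countType) (X : T -> K) (A : set T) :
  measurable A -> (forall k, measurable (X @^-1` [set k])) ->
  (forall k, m (A `&` X @^-1` [set k]) = 0%E) -> m A = 0%E.
Proof.
move=> mA mX A0; rewrite (@measure_eq_fibres _ _ _ m _ X A A 0) ?mul0e// => k.
by rewrite mul0e A0.
Qed.

(** * Measurability of events of the chain *)

Section chain_measurability.
Context (R : realType) (lam mu : R) (d : measure_display)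
  (T : measurableType d) (Y : controlled_chain lam mu T).

Lemma measurable_state t z : measurable (chain_state Y t @^-1` [set z]).
Proof.
case: z => b x; rewrite (_ : _ @^-1` _ = avail Y t @^-1` [set b] `&`
  age Y t @^-1` [set x]).
  by apply: measurableI; rewrite -[X in measurable X]setTI; exact: measurable_funP.
by apply/seteqP; split => w /= => [[]|[<- <-]].
Qed.

Lemma measurable_action t b : measurable (action Y t @^-1` [set b]).
Proof. by rewrite -[X in measurable X]setTI; exact: measurable_funP. Qed.

Lemma historyS t w :
  history Y t.+1 w = rcons (history Y t w) (chain_state Y t w, action Y t w).
Proof. by rewrite /history mkseqS. Qed.

Lemma measurable_history t h : measurable (history Y t @^-1` [set h]).
Proof.
elim: t h => [|t IH] h.
  by have [->|h0] := pselect (h = [::]);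
    [rewrite (_ : _ @^-1` _ = setT)//; apply/seteqP|
     rewrite (_ : _ @^-1` _ = set0)//; rewrite -subset0 => w /= /esym].
case/lastP: h => [|h [z b]].
  rewrite (_ : _ @^-1` _ = set0)// -subset0 => w hw.
  by have := congr1 size (hw : _ = _); rewrite historyS size_rcons.
rewrite (_ : _ @^-1` _ = history Y t @^-1` [set h] `&`
    (chain_state Y t @^-1` [set z] `&` action Y t @^-1` [set b])).
  apply: measurableI; first exact: IH.
  by apply: measurableI; [exact: measurable_state|exact: measurable_action].
apply/seteqP; split => [w hw|w [/= hw [zw bw]]].
  by have := hw : _ = _; rewrite historyS => /rcons_inj [].
by have := historyS t w; rewrite hw zw bw.
Qed.

Lemma measurable_history_action t h b :
  measurable ((fun w => (history Y t w, action Y t w)) @^-1` [set (h, b)]).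
Proof.
rewrite (_ : _ @^-1` _ = history Y t @^-1` [set h] `&` action Y t @^-1` [set b]).
  by apply: measurableI; [exact: measurable_history|exact: measurable_action].
by apply/seteqP; split => w /= => [[]|[<- <-]].
Qed.

Lemma measurable_state_action t (B : set (state * bool)) :
  measurable ((fun w => (chain_state Y t w, action Y t w)) @^-1` B).
Proof.
apply: measurable_fibres => -[z b].
rewrite (_ : _ @^-1` _ =
    chain_state Y t @^-1` [set z] `&` action Y t @^-1` [set b]).
  by apply: measurableI; [exact: measurable_state|exact: measurable_action].
by apply/seteqP; split => w /= => [[]|[<- <-]].
Qed.

Lemma measurable_fun_state t (f : state -> R) :
  measurable_fun setT (EFin \o (f \o chain_state Y t)).
Proof.
move=> _ B mB; rewrite setTI (_ : _ @^-1` _ =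
  chain_state Y t @^-1` ((EFin \o f) @^-1` B))//.
by apply: measurable_fibres; exact: measurable_state.
Qed.

Lemma measurable_fun_action t (f : bool -> R) :
  measurable_fun setT (EFin \o (f \o action Y t)).
Proof.
move=> _ B mB; rewrite setTI (_ : _ @^-1` _ =
  action Y t @^-1` ((EFin \o f) @^-1` B))//.
by apply: measurable_fibres; exact: measurable_action.
Qed.

End chain_measurability.

(** * The chain under the policy that takes a first action and then follows a threshold *)

(** The policy is deterministic and sees the past only through whether it is empty, so time and
    state determine the action. *)
Definition threshold_action (a : bool) (k t : nat) (z : state) : bool :=
  if t is 0 then a && z.1 else z.1 && (k < z.2)%N.

Lemma then_thresholdE (R : realType) a k h z :
  then_threshold R a k h z = (threshold_action a k (size h) z)%:R.
Proof. by case: h. Qed.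

Lemma admissible_then_threshold (R : realType) a k :
  admissible (then_threshold R a k).
Proof.
move=> h z; rewrite then_thresholdE ler0n lern1 leq_b1; split => //.
by case: z => -[]//= x _; case: (size h) => //=; rewrite andbF.
Qed.

Section threshold_chain.
Context (R : realType) (lam mu : R) (d : measure_display)
  (T : measurableType d) (Y : controlled_chain lam mu T) (a : bool) (k i : nat).
Hypothesis i_gt0 : (0 < i)%N.

Let P := Pr Y (then_threshold R a k) (true, i).
Let S := chain_state Y.
Let act := threshold_action a k.

(** On each event with fixed history and state the action law has factor 0 or 1, so the deviating
    part is null; there are countably many such events. *)
Lemma threshold_action_ae t :
  P [set w | action Y t w != act t (S t w)] = 0%E.
Proof.
have mN z : measurable [set w | action Y t w != act t z].
  rewrite (_ : mkset _ = action Y t @^-1` [set ~~ act t z]).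
    exact: measurable_action.
  by apply/seteqP; split => w /=; [case: (action _ _ _) (act _ _) => -[]|
    move=> ->; case: (act _ _)].
have mSN z : measurable (S t @^-1` [set z] `&` [set w | action Y t w != act t z]).
  by apply: measurableI => //; exact: measurable_state.
have SN z : [set w | action Y t w != act t (S t w)] `&` S t @^-1` [set z]
    = S t @^-1` [set z] `&` [set w | action Y t w != act t z].
  by apply/seteqP; split => w /= [] => [+ <-|<-].
have mA : measurable [set w | action Y t w != act t (S t w)].
  exact: (measurable_state_action Y t [set x | x.2 != act t x.1]).
apply: (measure0_fibres (X := S t)) => //; first exact: measurable_state.
move=> z; rewrite SN.
apply: (measure0_fibres (X := history Y t)) => //; first exact: measurable_history.
(* A list of length other than [t] is never the history at time [t]; the right length decides which
   clause of [threshold_action] applies. *)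
move=> h; have [ht|/eqP ht] := eqVneq (size h) t; last first.
  rewrite (_ : _ `&` _ = set0) ?measure0// -subset0 => w [_ hw].
  by apply: ht; rewrite -(hw : _ = _) /history size_mkseq.
have := action_law Y t h z (admissible_then_threshold R a k) (i_gt0 : (0 < (true, i).2)%N).
rewrite then_thresholdE ht -/act -/P.
set B := (X in (_ = P X * _)%E -> _); set A1 := (X in (P X = _)%E -> _) => lawA.
have mB : measurable B.
  by apply: measurableI; [exact: measurable_history|exact: measurable_state].
have mA1 : measurable A1.
  rewrite (_ : A1 = B `&` action Y t @^-1` [set true]).
    by apply: measurableI => //; exact: measurable_action.
  by apply/seteqP; split => w /= [] // [].
(* If the prescribed action is 0, the deviating event is [A1] itself, of probability 0. If it is 1,
   the event is [B] minus [A1], null because [P A1 = P B]. *)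
case E : (act t z) lawA => /= lawA; last first.
  rewrite (_ : _ `&` _ = A1) ?lawA ?mule0//; apply/seteqP; split => w /=.
    by move=> [[Sz nA] hw]; split => //; case: (action _ _ _) nA.
  by move=> [hw Sz Aw]; rewrite Aw.
rewrite mule1 in lawA.
have : (P B = P (B `\` A1) + P (B `&` A1))%E by exact: measureDI.
have -> : B `&` A1 = A1.
  by apply/seteqP; split => w; [case|move=> A1w; split => //; case: A1w].
have mBA1 : measurable (B `\` A1) by exact: measurableD.
rewrite lawA => /(congr1 fine); rewrite fineD ?fin_num_measure// => PB.
have {}PB : P (B `\` A1) = 0%E.
  by rewrite -[LHS]fineK ?fin_num_measure//; congr EFin; lra.
rewrite -PB; congr (P _).
apply/seteqP; split => w /=.
  by move=> [[Sz nA] hw]; split => // -[_ _ /eqP]; rewrite (negbTE nA).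
by move=> [[hw Sz] nA]; split => //; split => //; apply/eqP => At; apply: nA.
Qed.

(** Markov property: the transition factor is the same for every history that ends with the
    prescribed action, so it survives summation over histories. *)
Lemma transition_state t z z' :
  (P (S t.+1 @^-1` [set z'] `&` S t @^-1` [set z]) =
   (trans lam mu z (act t z) z')%:E * P (S t @^-1` [set z]))%E.
Proof.
apply: (measure_eq_fibres (X := fun w => (history Y t w, action Y t w))).
- by apply: measurableI; exact: measurable_state.
- exact: measurable_state.
- by move=> [h b]; exact: measurable_history_action.
move=> [h b].
have histE : S t @^-1` [set z] `&` (fun w => (history Y t w, action Y t w))
    @^-1` [set (h, b)] = [set w | history Y t.+1 w = rcons h (z, b)].
  apply/seteqP; split => w.
    by move=> [Sz [hw Aw]]; rewrite /mkset historyS hw Aw -(Sz : _ = _).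
  move=> hw; have := hw : _ = _; rewrite historyS => /rcons_inj [{}hw Sz Aw].
  by split => //; rewrite /preimage /= hw Aw.
have := transition_law Y t h z b z' (admissible_then_threshold R a k)
  (i_gt0 : (0 < (true, i).2)%N).
rewrite -/P -histE => law.
rewrite (_ : _ `&` _ = [set w | history Y t.+1 w = rcons h (z, b) /\
    S t.+1 w = z']) ?law; last first.
  rewrite -setIA histE setIC.
  by apply/seteqP; split.
(* For the prescribed action this is the transition law; for the other one both sides vanish, since
   the event lies in the null set of deviations. *)
rewrite muleC; have [->//|nb] := eqVneq b (act t z).
rewrite (_ : P (_ `&` _) = 0%E) ?mule0//.
apply: (subset_measure0 _ _ _ (threshold_action_ae t)).
- apply: measurableI; first exact: measurable_state.
  exact: measurable_history_action.
- exact: (measurable_state_action Y t [set x | x.2 != act t x.1]).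
- by move=> w [Sz [hw Aw]] /=; rewrite Aw (Sz : _ = _).
Qed.

Lemma state0 : P (S 0%N @^-1` [set (true, i)]) = 1%E.
Proof. exact: (initial_law Y (admissible_then_threshold R a k)). Qed.

(** The age grows by at most one per slot. Hence only finitely many states carry mass at a given
    time, and expectations become finite sums. *)
Lemma state_age_le t z : (i + t < z.2)%N -> P (S t @^-1` [set z]) = 0%E.
Proof.
elim: t z => [|t IH] z zit.
  (* The initial state already has mass one, which leaves none for a disjoint event. *)
  have : P (S 0%N @^-1` [set z] `|` S 0%N @^-1` [set (true, i)]) =
      (P (S 0%N @^-1` [set z]) + P (S 0%N @^-1` [set (true, i)]))%E.
    rewrite measureU//; try exact: measurable_state.
    rewrite -subset0 => w [Sz Sw]; move: zit.
    by rewrite -(Sz : _ = z) (Sw : _ = _) addn0 ltnn.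
  move=> PU; have := @probability_le1 _ _ _ P
    (S 0%N @^-1` [set z] `|` S 0%N @^-1` [set (true, i)]).
  rewrite PU state0 => /(_ _)/wrap[].
    by apply: measurableU; exact: measurable_state.
  rewrite -[leRHS]add0e leeD2rE// => P0.
  by apply/eqP; rewrite eq_le P0 measure_ge0.
apply: (measure0_fibres (X := S t)); try exact: measurable_state.
move=> z1; rewrite transition_state.
have [z1it|z1it] := ltnP (i + t) z1.2; first by rewrite IH// mule0.
rewrite (_ : trans _ _ _ _ _ = 0) ?mul0e// /trans /age_trans.
have -> : (z.2 == z1.2.+1) = false.
  by apply/eqP => E; move: zit; rewrite E addnS ltnS ltnNge z1it.
have -> : (z.2 == 1%N) = false.
  by apply/eqP => E; move: zit; rewrite E addnS ltnS ltn0.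
by case: (z1.1 && _); rewrite !(mulr0, addr0).
Qed.

End threshold_chain.

(** * One-step expectations *)

Definition mean_over_bit (R : realType) (lam : R) (phi : state -> R) (x : nat)
    : R :=
  lam * phi (true, x) + (1 - lam) * phi (false, x).

(** The conditional expectation of [phi] at time [t.+1] given state [z] at time [t]; [s] is the
    probability that the age is reset. *)
Definition next_mean (R : realType) (lam mu : R) (a : bool) (k t : nat)
    (phi : state -> R) (z : state) : R :=
  let s := if threshold_action a k t z then mu else 0 in
  s * mean_over_bit lam phi 1 + (1 - s) * mean_over_bit lam phi z.2.+1.

Lemma sum_ord_eq (R : realType) N (f : nat -> R) m :
  (m < N)%N -> \sum_(x < N) f x * (x == m :> nat)%:R = f m.
Proof.
move=> mN; rewrite (bigD1 (Ordinal mN))//= eqxx mulr1 big1 ?addr0// => x xm.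
by rewrite (_ : (_ == _) = false) ?mulr0//; apply/negbTE.
Qed.

(** Ages up to [N] suffice, since [z.2 < N] puts both possible successors, 1 and [z.2.+1], in the
    range. *)
Lemma sum_trans (R : realType) (lam mu : R) a k t N (phi : state -> R) z :
  (z.2 < N)%N ->
  \sum_(z' : bool * 'I_N.+1) phi (z'.1, z'.2 : nat) *
      trans lam mu z (threshold_action a k t z) (z'.1, z'.2 : nat)
  = next_mean lam mu a k t phi z.
Proof.
move=> zN; set u := threshold_action a k t z.
pose s := if u then mu else 0.
have ageE x : age_trans mu z u x = s * (x == 1%N)%:R + (1 - s) * (x == z.2.+1)%:R.
  rewrite /age_trans /s; case: ifPn => [/andP[_ ->]//|zu].
  (* A prescribed transmission presupposes an available packet, so the test [z.1 && u] is just
     [u]. *)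
  suff -> : u = false by rewrite mul0r add0r subr0 mul1r.
  apply: contraNF zu => uT; rewrite uT andbT; move: uT.
  by rewrite /u /threshold_action; case: (t) => [|_] /andP[].
transitivity (\sum_(b : bool) \sum_(x < N.+1)
    (if b then lam else 1 - lam) *
    (s * (phi (b, x : nat) * (x == 1%N :> nat)%:R) +
     (1 - s) * (phi (b, x : nat) * (x == z.2.+1 :> nat)%:R))).
  rewrite pair_bigA; apply: eq_bigr => -[b x] _ /=.
  by rewrite /trans /= ageE; ring.
rewrite big_bool /= -!mulr_sumr !big_split /= -!mulr_sumr.
rewrite !(sum_ord_eq (fun x => phi (_, x))) ?ltnS// ?(leq_trans _ zN)//.
by rewrite /next_mean -/u -/s /mean_over_bit; ring.
Qed.

Lemma mean_over_bit_ge0 (R : realType) (lam : R) phi x : 0 <= lam <= 1 ->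
  (forall b, 0 <= phi (b, x)) -> 0 <= mean_over_bit lam phi x.
Proof.
by move=> /andP[lam0 lam1] phi0; rewrite addr_ge0// mulr_ge0// subr_ge0.
Qed.

Lemma next_mean_ge0 (R : realType) (lam mu : R) a k t phi z :
  0 <= lam <= 1 -> 0 <= mu <= 1 -> (forall b x, (0 < x)%N -> 0 <= phi (b, x)) ->
  0 <= next_mean lam mu a k t phi z.
Proof.
move=> lam01 /andP[mu0 mu1] phi0; rewrite /next_mean.
have s0 : 0 <= (if threshold_action a k t z then mu else 0) by case: ifP.
have s1 : (if threshold_action a k t z then mu else 0) <= 1 by case: ifP.
by rewrite addr_ge0// mulr_ge0 ?subr_ge0// mean_over_bit_ge0// => b; exact: phi0.
Qed.

Section threshold_chain_expectation.
Context (R : realType) (lam mu : R) (d : measure_display)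
  (T : measurableType d) (Y : controlled_chain lam mu T) (a : bool) (k i : nat).
Hypothesis i_gt0 : (0 < i)%N.

Let P := Pr Y (then_threshold R a k) (true, i).
Let S := chain_state Y.
Let act := threshold_action a k.
Let at_state t N (z : bool * 'I_N) := S t @^-1` [set (z.1, z.2 : nat)].

(** The truncation to ages below [N] is exact: the age at time [t] is almost surely at most
    [i + t]. *)
Lemma integral_over_states t N (f : T -> \bar R) : (i + t < N)%N ->
  measurable_fun setT f -> (forall w, 0 <= f w)%E ->
  (\int[P]_w f w = \sum_(z : bool * 'I_N) \int[P]_(w in at_state t z) f w)%E.
Proof.
move=> itN mf f0.
have mS z : measurable (@at_state t N z) by exact: measurable_state.
set D := \big[setU/set0]_(z : bool * 'I_N) at_state t z.
have mD : measurable D by exact: bigsetU_measurable.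
have DC0 : P (~` D) = 0%E.
  apply: (measure0_fibres (X := S t)); [exact: measurableC|exact: measurable_state|].
  move=> -[b x]; have [xN|Nx] := ltnP x N.
    rewrite (_ : _ `&` _ = set0) ?measure0// -subset0 => w [+ Sw]; apply.
    rewrite /D -bigcup_seq; exists (b, Ordinal xN) => //=.
    by rewrite mem_index_enum.
  apply: (subset_measure0 _ _ (@subIsetr _ _ _)).
  - by apply: measurableI; [exact: measurableC|exact: measurable_state].
  - exact: measurable_state.
  - by apply: state_age_le => //; exact: leq_trans Nx.
rewrite (ge0_negligible_integral _ _ _ _ DC0)//; last exact: measurableC.
rewrite setTD setCK ge0_integral_bigsetU//.
- exact: index_enum_uniq.
- apply/trivIsetP => -[b x] -[b' x'] _ _ /eqP xx'; rewrite -subset0 => w [Sw Sw'].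
  apply: xx'; have := Sw : _ = _; rewrite (Sw' : _ = _) => -[-> xx'].
  by congr pair; exact: val_inj.
- exact: measurable_funS mf.
Qed.

Lemma expectation_state t N (phi : state -> R) : (i + t < N)%N ->
  (forall b x, (0 < x)%N -> 0 <= phi (b, x)) ->
  (\int[P]_w (phi (S t w))%:E =
   (\sum_(z : bool * 'I_N) phi (z.1, z.2 : nat) * fine (P (at_state t z)))%:E)%E.
Proof.
move=> itN phi0; rewrite (integral_over_states itN).
- rewrite -sumEFin; apply: eq_bigr => z _; rewrite EFinM fineK ?fin_num_measure//;
    last exact: measurable_state.
  rewrite -integral_cst; last exact: measurable_state.
  by apply: eq_integral => w /set_mem Sw; rewrite (Sw : _ = _).
- exact: measurable_fun_state.
- by move=> w; rewrite lee_fin; apply: phi0; exact: age_pos.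
Qed.

Lemma state_law_step t N z' : (i + t < N)%N ->
  fine (P (S t.+1 @^-1` [set z'])) =
  \sum_(z : bool * 'I_N) trans lam mu (z.1, z.2 : nat) (act t (z.1, z.2 : nat)) z'
     * fine (P (at_state t z)).
Proof.
move=> itN; have mS t' z : measurable (S t' @^-1` [set z]) by exact: measurable_state.
apply: EFin_inj; rewrite fineK ?fin_num_measure//.
(* The probability is written as the integral of an indicator, so that it splits over the states at
   time [t]. *)
rewrite -[in LHS](setIT (S t.+1 @^-1` _)) -integral_indic//.
rewrite (integral_over_states itN); last 2 first.
- by apply: measurableT_comp => //; exact: measurable_indic.
- by move=> w; rewrite lee_fin.
rewrite -sumEFin; apply: eq_bigr => z _.
rewrite integral_indic; [|exact: mS|exact: mS].
rewrite EFinM fineK ?fin_num_measure//; last exact: mS.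
exact: transition_state.
Qed.

Lemma expectation_step t (phi : state -> R) :
  0 <= lam <= 1 -> 0 <= mu <= 1 -> (forall b x, (0 < x)%N -> 0 <= phi (b, x)) ->
  (\int[P]_w (phi (S t.+1 w))%:E =
   \int[P]_w (next_mean lam mu a k t phi (S t w))%:E)%E.
Proof.
move=> lam01 mu01 phi0; pose N := (i + t).+1.
rewrite (@expectation_state _ N.+1)// ?addnS//.
rewrite (@expectation_state _ N)//; last by move=> *; exact: next_mean_ge0.
congr EFin.
under eq_bigr => z' _ do rewrite (@state_law_step t N)// mulr_sumr.
rewrite exchange_big/=; apply: eq_bigr => z _.
rewrite -(@sum_trans _ lam mu a k t N); last exact: ltn_ord.
rewrite mulr_suml.
by apply: eq_bigr => z' _; rewrite mulrA.
Qed.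

Lemma expectation_state0 (phi : state -> R) :
  (forall b x, (0 < x)%N -> 0 <= phi (b, x)) ->
  (\int[P]_w (phi (S 0%N w))%:E = (phi (true, i))%:E)%E.
Proof.
move=> phi0; rewrite (@expectation_state _ i.+1) ?addn0//; congr EFin.
have mS z : measurable (S 0%N @^-1` [set z]) by exact: measurable_state.
have P1 : P (S 0%N @^-1` [set (true, i)]) = 1%E by exact: state0.
rewrite (bigD1 (true, ord_max))//= /at_state /= P1 mulr1 big1 ?addr0// => -[b x] bx.
suff -> : P (S 0%N @^-1` [set (b, x : nat)]) = 0%E by rewrite mulr0.
apply: (@subset_measure0 _ _ _ P _ (~` (S 0%N @^-1` [set (true, i)]))) => //.
- exact: measurableC.
- move=> w Sw Sw'; have := Sw : _ = _; rewrite (Sw' : _ = _) => -[bT ix].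
  by move/eqP: bx; apply; rewrite -bT; congr pair; exact: val_inj.
- have PC : P (~` (S 0%N @^-1` [set (true, i)])) =
      (1 - P (S 0%N @^-1` [set (true, i)]))%E by exact: probability_setC.
  by rewrite [LHS]PC P1 subee.
Qed.

End threshold_chain_expectation.

(** * Reduction to the age and series form of the discounted totals *)

(** The transition operator of the age under the [k]-policy once the bit is averaged out; a reset
    needs both a packet and a success, whence [p] is their joint probability in the applications. *)
Definition age_step (R : realType) (p : R) (k : nat) (r : nat -> R) (x : nat)
    : R :=
  let s := if (k < x)%N then p else 0 in s * r 1%N + (1 - s) * r x.+1.

(** Only times [t.+1] are concerned, where the threshold rule holds; at time 0 the action is the
    free one. *)
Lemma mean_next (R : realType) (lam mu : R) a k t phi :
  mean_over_bit lam (next_mean lam mu a k t.+1 phi)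
  = age_step (lam * mu) k (mean_over_bit lam phi).
Proof.
apply/funext => x; rewrite {1}/mean_over_bit /next_mean /age_step /=.
by case: ifP => _; ring.
Qed.

Definition disc_partial (R : realType) (p : R) (k : nat) (beta : R)
    (r : nat -> R) (n x : nat) : R :=
  \sum_(0 <= m < n) beta ^+ m * iter m (age_step p k) r x.

Lemma disc_partialS (R : realType) (p : R) k beta r n x :
  disc_partial p k beta r n.+1 x =
  r x + beta * age_step p k (disc_partial p k beta r n) x.
Proof.
rewrite /disc_partial big_nat_recl//= expr0 mul1r; congr (_ + _).
rewrite /age_step !mulr_sumr -big_split mulr_sumr; apply: eq_bigr => m _ /=.
by rewrite exprS; ring.
Qed.

Lemma nneseries_disc (R : realType) (p : R) k beta r (e : nat -> R) s i w1 w :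
  (forall t, e t.+1 = s * iter t (age_step p k) r 1%N
                      + (1 - s) * iter t (age_step p k) r i.+1) ->
  disc_partial p k beta r n 1 @[n --> \oo] --> w1 ->
  disc_partial p k beta r n i.+1 @[n --> \oo] --> w ->
  (\sum_(0 <= t <oo) (e t * beta ^+ t)%:E =
   (e 0%N + beta * (s * w1 + (1 - s) * w))%:E)%E.
Proof.
move=> eE cvg1 cvgi.
suff cvge : \sum_(0 <= t < n) e t * beta ^+ t @[n --> \oo] -->
    e 0%N + beta * (s * w1 + (1 - s) * w).
  apply/cvg_lim => //; under eq_fun do rewrite sumEFin.
  by apply: cvg_comp cvge _.
rewrite -cvg_shiftS /=.
have -> : (fun n => \sum_(0 <= t < n.+1) e t * beta ^+ t) =
    (fun n => e 0%N + beta * (s * disc_partial p k beta r n 1 +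
                              (1 - s) * disc_partial p k beta r n i.+1)).
  apply/funext => n; rewrite big_nat_recl//= expr0 mulr1; congr (_ + _).
  rewrite /disc_partial !mulr_sumr -big_split mulr_sumr; apply: eq_bigr => m _ /=.
  by rewrite eE exprS; ring.
apply: cvgD; first exact: cvg_cst.
by apply: cvgMr; apply: cvgD; apply: cvgMr.
Qed.

Section threshold_chain_discounted.
Context (R : realType) (lam mu : R) (d : measure_display)
  (T : measurableType d) (Y : controlled_chain lam mu T) (a : bool) (k i : nat).
Hypothesis i_gt0 : (0 < i)%N.
Hypotheses (lam01 : 0 <= lam <= 1) (mu01 : 0 <= mu <= 1).

Let P := Pr Y (then_threshold R a k) (true, i).
Let S := chain_state Y.
Let s := if a then mu else 0.

(** The first slot leads from [(true, i)] to age 1 with probability [s] and to age [i.+1] otherwise,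
    with a fresh bit; from then on the averaged age operator acts. *)
Lemma expectation_iter t (phi : state -> R) :
  (forall b x, (0 < x)%N -> 0 <= phi (b, x)) ->
  let U := iter t (age_step (lam * mu) k) (mean_over_bit lam phi) in
  (\int[P]_w (phi (S t.+1 w))%:E = (s * U 1%N + (1 - s) * U i.+1)%:E)%E.
Proof.
elim: t phi => [|t IH] phi phi0; rewrite /= expectation_step//.
  rewrite expectation_state0//; last by move=> *; exact: next_mean_ge0.
  by rewrite /next_mean /= andbT.
rewrite IH; last by move=> *; exact: next_mean_ge0.
by rewrite mean_next -iterSr.
Qed.

(** Nonnegativity allows termwise integration; the expectations then form the series of
    [nneseries_disc]. *)
Lemma discounted_costE (c : nat -> R) beta w1 w :
  0 <= beta -> (forall x, (0 < x)%N -> 0 <= c x) ->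
  disc_partial (lam * mu) k beta c n 1 @[n --> \oo] --> w1 ->
  disc_partial (lam * mu) k beta c n i.+1 @[n --> \oo] --> w ->
  discounted_cost Y c beta (then_threshold R a k) (true, i) =
  (c i + beta * (s * w1 + (1 - s) * w))%:E.
Proof.
move=> beta0 c0 cvg1 cvgi.
pose phi (z : state) := c z.2.
have mphi t : measurable_fun setT (EFin \o (phi \o S t)).
  exact: measurable_fun_state.
have cS0 t w' : (0 <= (phi (S t w'))%:E)%E by rewrite lee_fin c0//; exact: age_pos.
have meanE : mean_over_bit lam phi = c.
  by apply/funext => x; rewrite /mean_over_bit /phi /=; ring.
pose e t := fine (\int[P]_w' (phi (S t w'))%:E).
have e0 : e 0%N = c i by rewrite /e expectation_state0//= => b x; exact: c0.
have eE t : (\int[P]_w' (c (age Y t w') * beta ^+ t)%:E = (e t * beta ^+ t)%:E)%E.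
  under eq_integral do rewrite EFinM.
  rewrite (@ge0_integralZr _ _ _ _ _ _ (EFin \o (phi \o S t)))//; last 2 first.
    by move=> w' _; exact: cS0.
    by rewrite lee_fin exprn_ge0.
  rewrite EFinM /e fineK//; case: t => [|t].
    by rewrite expectation_state0// => b x; exact: c0.
  by rewrite expectation_iter// => b x; exact: c0.
rewrite /discounted_cost integral_nneseries//; last 2 first.
- move=> t; under eq_fun do rewrite EFinM.
  by apply: emeasurable_funM => //; exact: mphi.
- move=> t w' _; rewrite lee_fin mulr_ge0 ?exprn_ge0//.
  exact: cS0.
under eq_eseriesr do rewrite eE.
rewrite (@nneseries_disc _ (lam * mu) k beta c e s i w1 w)// ?e0// => t.
by rewrite /e expectation_iter ?meanE// => b x; exact: c0.
Qed.

Lemma discounted_workE beta w1 w :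
  let r x := lam * (k < x)%N%:R in
  0 <= beta ->
  disc_partial (lam * mu) k beta r n 1 @[n --> \oo] --> w1 ->
  disc_partial (lam * mu) k beta r n i.+1 @[n --> \oo] --> w ->
  discounted_work Y beta (then_threshold R a k) (true, i) =
  (a%:R + beta * (s * w1 + (1 - s) * w))%:E.
Proof.
move=> r beta0 cvg1 cvgi.
pose phi t (z : state) : R := (threshold_action a k t z)%:R.
have phi0 t b x : (0 < x)%N -> 0 <= phi t (b, x) by rewrite ler0n.
have mphi t : measurable_fun setT (EFin \o (phi t \o S t)).
  exact: measurable_fun_state.
have meanE t : mean_over_bit lam (phi t.+1) = r.
  by apply/funext => x; rewrite /mean_over_bit /phi /r /=; ring.
have mA t : measurable_fun setT (EFin \o ((fun b : bool => b%:R : R) \o action Y t)).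
  exact: (measurable_fun_action Y t (fun b => (b : nat)%:R)).
pose e t := fine (\int[P]_w' (phi t (S t w'))%:E).
have e0 : e 0%N = a%:R by rewrite /e expectation_state0//= /phi /= andbT.
have eE t : (\int[P]_w' ((action Y t w' : nat)%:R * beta ^+ t)%:E
             = (e t * beta ^+ t)%:E)%E.
  under eq_integral do rewrite EFinM.
  rewrite (@ge0_integralZr _ _ _ _ _ _
    (EFin \o ((fun b : bool => b%:R : R) \o action Y t))); last 4 first.
  - by [].
  - exact: mA.
  - by move=> w' _; rewrite lee_fin.
  - by rewrite lee_fin exprn_ge0.
  rewrite EFinM; congr (_ * _)%E.
  (* The action is not a function of the state, but almost surely equals its prescribed value, which
     is one. *)
  transitivity (\int[P]_w' (phi t (S t w'))%:E)%E.
    apply: ge0_ae_eq_integral.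
    - by [].
    - exact: mA.
    - exact: mphi.
    - by move=> w' _; rewrite lee_fin.
    - by move=> w' _; rewrite lee_fin.
    - exists [set w' | action Y t w' != threshold_action a k t (S t w')]; split.
      + exact: (measurable_state_action Y t
          [set x | x.2 != threshold_action a k t x.1]).
      + exact: threshold_action_ae.
      + move=> w' /= nA; apply/eqP => A; apply: nA => _.
        by rewrite A /phi.
  rewrite fineK//; case: t => [|t].
    by rewrite expectation_state0.
  by rewrite expectation_iter.
rewrite /discounted_work integral_nneseries//; last 2 first.
- move=> t; under eq_fun do rewrite EFinM.
  by apply: emeasurable_funM => //; exact: mA.
- by move=> t w' _; rewrite lee_fin mulr_ge0 ?exprn_ge0.
under eq_eseriesr do rewrite eE.
rewrite (@nneseries_disc _ (lam * mu) k beta r e s i w1 w)// ?e0// => t.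
by rewrite /e expectation_iter//= meanE.
Qed.

End threshold_chain_discounted.

(** * Tail power series and their limit at the left of 1 *)

(** For [r = c] and [y = q] this is the tail series $C_x(q)$, including the case [q = 0] because
    [0 ^+ 0] is 1. *)
Definition gen_tail (R : realType) (r : nat -> R) (y : R) (x : nat) : R :=
  limn (series (fun j => y ^+ j * r (x + j)%N)).

Lemma gen_tail_cvg (R : realType) (r : nat -> R) (y q : R) x :
  (forall j, 0 <= r (x + j)%N) -> 0 <= y <= q ->
  cvgn (series (fun j => q ^+ j * r (x + j)%N)) ->
  cvgn (series (fun j => y ^+ j * r (x + j)%N)).
Proof.
move=> r0 /andP[y0 yq]; apply: series_le_cvg => j.
- by rewrite mulr_ge0 ?exprn_ge0.
- by rewrite mulr_ge0 ?exprn_ge0// (le_trans y0).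
- by rewrite ler_wpM2r// lerXn2r// nnegrE (le_trans y0).
Qed.

Lemma gen_tailS (R : realType) (r : nat -> R) (y : R) x :
  cvgn (series (fun j => y ^+ j * r (x.+1 + j)%N)) ->
  gen_tail r y x = r x + y * gen_tail r y x.+1.
Proof.
move=> cvgx; apply/cvg_lim => //; rewrite -cvg_shiftS /=.
have -> : (fun n => series (fun j => y ^+ j * r (x + j)%N) n.+1) =
    (fun n => r x + y * series (fun j => y ^+ j * r (x.+1 + j)%N) n).
  apply/funext => n; rewrite /series /= big_nat_recl//= expr0 mul1r addn0.
  congr (_ + _); rewrite mulr_sumr; apply: eq_bigr => j _.
  by rewrite exprS mulrA addSnnS.
by apply: cvgD; [exact: cvg_cst|exact: cvgMr].
Qed.

Lemma gen_tail_ge0 (R : realType) (r : nat -> R) (y : R) x : 0 <= y ->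
  (forall j, 0 <= r (x + j)%N) ->
  cvgn (series (fun j => y ^+ j * r (x + j)%N)) -> 0 <= gen_tail r y x.
Proof.
move=> y0 r0 cvgx; apply: limr_ge => //; apply: nearW => n.
by rewrite /series /= sumr_ge0// => j _; rewrite mulr_ge0 ?exprn_ge0.
Qed.

(** Abel's theorem for nonnegative terms: for [b] below 1 the sum is at most [A] and at least a
    partial sum, which is continuous in [b] and close to [A] at 1. *)
Lemma abel_cvg (R : realType) (a : nat -> R) : (forall j, 0 <= a j) ->
  cvgn (series a) ->
  limn (series (fun j => b ^+ j * a j)) @[b --> (1 : R)^'-] --> limn (series a).
Proof.
move=> a0 cvga; set A := limn _.
have leA n : series a n <= A.
  apply: nondecreasing_cvgn_le => //; apply/nondecreasing_seqP => m.
  by rewrite /series /= big_nat_recr//= lerDl.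
have term_ge0 (b : R) j : 0 <= b -> 0 <= b ^+ j * a j.
  by move=> b0; rewrite mulr_ge0 ?exprn_ge0.
have cvgb (b : R) : 0 <= b <= 1 -> cvgn (series (fun j => b ^+ j * a j)).
  move=> /andP[b0 b1]; apply: series_le_cvg cvga => // j; first exact: term_ge0.
  by rewrite ler_piMl// exprn_ile1.
apply/cvgrPdist_lt => e e0.
have [n An] : exists n, A - e < series a n.
  have : \forall n \near \oo, `|A - series a n| < e.
    by move/cvgrPdist_lt : cvga; apply.
  case=> n _ /(_ n (leqnn n)) /= An; exists n.
  by move: An; rewrite ltr_norml => /andP[]; lra.
have cvgn_b : series (fun j => b ^+ j * a j) n @[b --> (1 : R)^'-] --> series a n.
  have -> : series a n = \sum_(0 <= j < n) 1 ^+ j * a j.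
    by apply: eq_bigr => j _; rewrite expr1n mul1r.
  apply: cvg_big => [|j _]; first by move=> /= x; exact: add_continuous.
  apply: cvgMl; apply: (@cvg_at_left_filter _ _ (fun b : R => b ^+ j)).
  exact: exprn_continuous.
near=> b.
have b01 : 0 <= b <= 1.
  by apply/andP; split; apply: ltW; near: b; [exact: nbhs_left_gt|exact: nbhs_left_lt].
have b0 := proj1 (andP b01).
have nb : series (fun j => b ^+ j * a j) n <= limn (series (fun j => b ^+ j * a j)).
  apply: nondecreasing_cvgn_le; last exact: cvgb.
  apply/nondecreasing_seqP => m; rewrite /series /= big_nat_recr//= lerDl.
  exact: term_ge0.
have bA : limn (series (fun j => b ^+ j * a j)) <= A.
  apply: ler_lim => //; first exact: cvgb.
  apply: nearW => m; rewrite /series /=; apply: ler_sum => j _.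
  by rewrite ler_piMl// exprn_ile1//; case/andP: b01.
rewrite ger0_norm ?subr_ge0// ltrBlDr -ltrBlDl; apply: lt_le_trans nb.
by near: b; apply: (cvgr_gt _ cvgn_b).
Unshelve. all: by end_near. Qed.

(** * Explicit solution of the age recursion when the threshold is [i] *)

Lemma age_step_le (R : realType) (p : R) k (r1 r2 : nat -> R) x :
  0 <= p <= 1 -> (forall y, (0 < y)%N -> r1 y <= r2 y) ->
  age_step p k r1 x <= age_step p k r2 x.
Proof.
move=> /andP[p0 p1] r12; rewrite /age_step.
by case: ifP => _; apply: lerD; apply: ler_wpM2l; rewrite ?r12// ?subr_ge0// subr0.
Qed.

Section threshold_value.
Context (R : realType) (p beta : R) (i : nat) (r : nat -> R).
Hypotheses (p01 : 0 < p <= 1) (beta01 : 0 < beta < 1) (i_gt0 : (0 < i)%N).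
Hypothesis r0 : forall x, (0 < x)%N -> 0 <= r x.
Let y := beta * (1 - p).
Hypothesis cvg_tail : forall x, (0 < x)%N ->
  cvgn (series (fun j => y ^+ j * r (x + j)%N)).

(** [theta] is the expected discount factor at the next reset, starting above the threshold. The
    values at ages 1 and [i.+1] solve the linear system [w1 = head + beta ^+ i * w],
    [w = gen_tail r y i.+1 + theta * w1], whose determinant is [denom]. *)
Let head : R := \sum_(0 <= j < i) beta ^+ j * r j.+1.
Let theta : R := beta * p / (1 - y).
Let denom : R := 1 - theta * beta ^+ i.
Let w1 : R := (head + beta ^+ i * gen_tail r y i.+1) / denom.
Let w : R := gen_tail r y i.+1 + theta * w1.

Let p_ge0 : 0 <= p. Proof. by move: p01; lra. Qed.
Let q_ge0 : 0 <= 1 - p. Proof. by move: p01; lra. Qed.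
Let p_le1 : p <= 1. Proof. by move: p01; lra. Qed.
Let p_in01 : 0 <= p <= 1. Proof. by rewrite p_ge0. Qed.
Let beta_ge0 : 0 <= beta. Proof. by move: beta01; lra. Qed.
Let beta_le1 : beta <= 1. Proof. by move: beta01; lra. Qed.

Let y_ge0 : 0 <= y.
Proof. by rewrite /y mulr_ge0. Qed.

Let y_lt1 : y < 1.
Proof.
have : 0 < beta * p by apply: mulr_gt0; [move: beta01|move: p01]; lra.
by rewrite /y; move: beta01; lra.
Qed.

Let theta_ge0 : 0 <= theta.
Proof. by rewrite /theta divr_ge0// ?mulr_ge0//; move: y_lt1; lra. Qed.

Let thetaE : theta = beta * p + y * theta.
Proof. by rewrite /theta; field; move: y_lt1; lra. Qed.

Let theta_lt1 : theta < 1.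
Proof. by rewrite /theta ltr_pdivrMr; move: y_lt1 beta01; rewrite /y; lra. Qed.

Let denom_gt0 : 0 < denom.
Proof.
have bi : beta ^+ i <= 1 by exact: exprn_ile1.
have b0 : 0 <= beta ^+ i by exact: exprn_ge0.
by rewrite /denom; move: theta_ge0 theta_lt1; nra.
Qed.

Let tail_ge0 x : (0 < x)%N -> 0 <= gen_tail r y x.
Proof.
move=> x0; apply: gen_tail_ge0 => //; last exact: cvg_tail.
by move=> j; apply: r0; rewrite addn_gt0 x0.
Qed.

Let w1_ge0 : 0 <= w1.
Proof.
rewrite divr_ge0//; last exact: ltW.
rewrite addr_ge0// ?mulr_ge0 ?exprn_ge0 ?tail_ge0//.
by rewrite sumr_ge0// => j _; rewrite mulr_ge0 ?exprn_ge0 ?r0.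
Qed.

Let w1E : w1 = head + beta ^+ i * w.
Proof.
rewrite /w mulrDr addrA; rewrite -[X in X + _](divfK (lt0r_neq0 denom_gt0)) -/w1.
by rewrite /denom; ring.
Qed.

(* [value] solves [v x = r x + beta * age_step v x], hence dominates all the
   partial sums. Conversely their limit [Vlim] solves the same equation, and
   dropping the nonnegative remainder when unrolling it gives [w1 <= Vlim 1]. *)
Let value (x : nat) : R :=
  if (i < x)%N then gen_tail r y x + theta * w1
  else \sum_(x <= j < i.+1) beta ^+ (j - x) * r j + beta ^+ (i.+1 - x) * w.

Let value1 : value 1 = w1.
Proof.
rewrite /value ltnNge i_gt0/= w1E subSS subn0; congr (_ + _).
by rewrite big_add1/=; apply: eq_bigr => j _; rewrite subSS subn0.
Qed.

Let valueS : value i.+1 = w.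
Proof. by rewrite /value ltnSn. Qed.

Let value_step x : (0 < x)%N ->
  value x = r x + beta * age_step p i value x.
Proof.
move=> x0; rewrite /age_step value1.
(* Three regimes: above the threshold the tail series unfolds, strictly below it the finite sum
   loses its first term, and at [x = i] the next age is the first one with value [w]. *)
have [ix|xi] := ltnP i x.
  rewrite /value ix leqW// gen_tailS; last exact: cvg_tail.
  by rewrite {1}thetaE /y; ring.
rewrite mul0r subr0 mul1r add0r; have [xi'|ix] := ltnP x i.
  rewrite /value [in LHS]ltnNge xi [in RHS]ltnNge xi'/=.
  rewrite big_ltn// subnn expr0 mul1r -addrA; congr (_ + _).
  rewrite [RHS]mulrDr mulr_sumr; congr (_ + _).
    rewrite !big_seq; apply: eq_bigr => j; rewrite mem_index_iota => /andP[xj _].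
    by rewrite mulrA -exprS -subSn// subSS.
  by rewrite mulrA -exprS -subSn// subSS.
have -> : x = i by apply/eqP; rewrite eqn_leq xi.
by rewrite valueS /value ltnn big_nat1 subnn expr0 mul1r subSnn expr1.
Qed.

Let value_ge0 x : (0 < x)%N -> 0 <= value x.
Proof.
move=> x0; have tw1 : 0 <= theta * w1 by exact: mulr_ge0.
have w_ge0 : 0 <= w by rewrite addr_ge0 ?tail_ge0.
rewrite /value; case: ifP => _; first by rewrite addr_ge0 ?tail_ge0.
rewrite addr_ge0 ?mulr_ge0 ?exprn_ge0//.
rewrite big_seq sumr_ge0// => j; rewrite mem_index_iota => /andP[xj _].
by rewrite mulr_ge0 ?exprn_ge0 ?r0 ?(leq_trans x0).
Qed.

Let V := disc_partial p i beta r.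

Let V_le_value n x : (0 < x)%N -> V n x <= value x.
Proof.
elim: n x => [|n IH] x x0.
  by rewrite /V /disc_partial big_geq// value_ge0.
rewrite /V disc_partialS value_step// lerD2l ler_wpM2l//.
by apply: age_step_le.
Qed.

Let V_ge0 n x : (0 < x)%N -> 0 <= V n x.
Proof.
elim: n x => [|n IH] x x0; first by rewrite /V /disc_partial big_geq.
rewrite /V disc_partialS addr_ge0 ?r0// mulr_ge0//.
by rewrite /age_step; case: ifP => _;
  rewrite addr_ge0// ?mulr_ge0 ?IH// ?subr_ge0// subr0.
Qed.

Let V_nondecr n x : (0 < x)%N -> V n x <= V n.+1 x.
Proof.
elim: n x => [|n IH] x x0; first by rewrite {1}/V /disc_partial big_geq ?V_ge0.
rewrite /V disc_partialS [leRHS]disc_partialS lerD2l ler_wpM2l//.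
by apply: age_step_le.
Qed.

Let V_cvg x : (0 < x)%N -> cvgn (V ^~ x).
Proof.
move=> x0; apply: nondecreasing_is_cvgn.
  by apply/nondecreasing_seqP => n; exact: V_nondecr.
by exists (value x) => _ [n _ <-]; exact: V_le_value.
Qed.

Let Vlim x := limn (V ^~ x).

Let Vlim_le x : (0 < x)%N -> Vlim x <= value x.
Proof.
by move=> x0; apply: limr_le; [exact: V_cvg|apply: nearW => n; exact: V_le_value].
Qed.

Let Vlim_ge0 x : (0 < x)%N -> 0 <= Vlim x.
Proof.
by move=> x0; apply: limr_ge; [exact: V_cvg|apply: nearW => n; exact: V_ge0].
Qed.

Let Vlim_step x : (0 < x)%N -> Vlim x = r x + beta * age_step p i Vlim x.
Proof.
move=> x0; apply/cvg_lim => //; rewrite -cvg_shiftS /=.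
under eq_fun do rewrite /V disc_partialS.
apply: cvgD; first exact: cvg_cst.
by apply: cvgMr; apply: cvgD; apply: cvgMr; exact: V_cvg.
Qed.

Let Vlim_head m : (m <= i)%N ->
  Vlim 1 = \sum_(0 <= j < m) beta ^+ j * r j.+1 + beta ^+ m * Vlim m.+1.
Proof.
elim: m => [|m IH] mi; first by rewrite big_geq// add0r expr0 mul1r.
rewrite IH ?(ltnW mi)// big_nat_recr//= -addrA; congr (_ + _).
rewrite Vlim_step// /age_step ltnNge mi/= exprS; ring.
Qed.

(** Above the threshold a step resets with weight [beta * p] and continues with weight [y], so the
    resets collect a geometric series; its limit produces [theta]. *)
Let Vlim_tail n x : (i < x)%N ->
  series (fun j => y ^+ j * r (x + j)%N) n
    + beta * p * Vlim 1 * series (fun j => y ^+ j) n <= Vlim x.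
Proof.
elim: n x => [|n IH] x ix.
  by rewrite /series /= !big_geq// mulr0 addr0 Vlim_ge0 ?(leq_trans _ ix).
have x0 : (0 < x)%N by exact: leq_trans ix.
have := IH x.+1 (leqW ix); rewrite [Vlim x]Vlim_step// /age_step ix.
move=> /(ler_wpM2l y_ge0).
rewrite /series /= !big_nat_recl//= !expr0 !mul1r addn0.
have -> : \sum_(0 <= j < n) y ^+ j.+1 * r (x + j.+1)%N =
    y * \sum_(0 <= j < n) y ^+ j * r (x.+1 + j)%N.
  by rewrite mulr_sumr; apply: eq_bigr => j _; rewrite exprS mulrA addSnnS.
have -> : \sum_(0 <= j < n) y ^+ j.+1 = y * \sum_(0 <= j < n) y ^+ j.
  by rewrite mulr_sumr; apply: eq_bigr => j _; rewrite exprS.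
have yV : y * Vlim x.+1 = beta * ((1 - p) * Vlim x.+1) by rewrite /y mulrA.
by rewrite yV; lra.
Qed.

Let Vlim_ge : gen_tail r y i.+1 + theta * Vlim 1 <= Vlim i.+1.
Proof.
have cvgs : series (fun j => y ^+ j * r (i.+1 + j)%N) n
    + beta * p * Vlim 1 * series (fun j => y ^+ j) n @[n --> \oo] -->
    gen_tail r y i.+1 + theta * Vlim 1.
  apply: cvgD; first exact: cvg_tail.
  rewrite (_ : theta * _ = beta * p * Vlim 1 * (1 / (1 - y))); last first.
    by rewrite /theta; ring.
  apply: cvgMr.
  rewrite (_ : (fun j => y ^+ j) = geometric 1 y); last first.
    by apply/funext => j; rewrite /= mul1r.
  by apply: cvg_geometric_series; rewrite ger0_norm.
rewrite -(cvg_lim _ cvgs)//; apply: limr_le; first by apply: cvgP cvgs.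
by apply: nearW => n; exact: Vlim_tail.
Qed.

Lemma threshold_value_cvg :
  disc_partial p i beta r n 1 @[n --> \oo] --> w1 /\
  disc_partial p i beta r n i.+1 @[n --> \oo] --> w.
Proof.
have V1 : Vlim 1 = w1.
  apply/eqP; rewrite eq_le -[in X in X && _]value1// Vlim_le//=.
  (* As [denom] is positive, the claim is that [head + beta ^+ i * (gen_tail r y i.+1 + theta * Vlim
     1)] is at most [Vlim 1]: unroll [i] steps, then use the tail bound. *)
  rewrite ler_pdivrMr// mulrBr mulr1 lerBrDr.
  rewrite {2}(Vlim_head (leqnn i)) -/head -addrA lerD2l.
  have b0 : 0 <= beta ^+ i by exact: exprn_ge0.
  by have := ler_wpM2l b0 Vlim_ge; rewrite mulrDr; lra.
have Vi : Vlim i.+1 = w.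
  apply/eqP; rewrite eq_le -[in X in X && _]valueS// Vlim_le//=.
  by rewrite /w -V1 Vlim_ge.
by split; [rewrite -V1|rewrite -Vi]; exact: V_cvg.
Qed.

End threshold_value.

(** * The difference of values and its limit as the discount factor tends to 1 *)

(** Writing the gap with [N] instead of a quotient by [1 - beta] removes the singularity at
    [beta = 1]. *)
Lemma threshold_value_gap (R : realType) (p beta : R) i (r : nat -> R) :
  0 < p <= 1 -> 0 < beta < 1 -> (0 < i)%N ->
  (forall x, (0 < x)%N -> 0 <= r x) ->
  (forall x, (0 < x)%N ->
    cvgn (series (fun j => (1 - p) ^+ j * r (x + j)%N))) ->
  let N := \sum_(j < i) beta ^+ j in
  exists w1 w,
  [/\ disc_partial p i beta r n 1 @[n --> \oo] --> w1,
      disc_partial p i beta r n i.+1 @[n --> \oo] --> w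
    & w - w1 = (N * (1 - beta * (1 - p)) * gen_tail r (beta * (1 - p)) i.+1
                - \sum_(0 <= j < i) beta ^+ j * r j.+1) / (1 + beta * p * N)].
Proof.
move=> p01 beta01 i0 r0 cvgr N.
have q0 : 0 <= 1 - p by lra.
have y01 : 0 <= beta * (1 - p) <= 1 - p.
  by rewrite mulr_ge0//= ?ler_piMl//; lra.
have [] := @threshold_value_cvg R p beta i r p01 beta01 i0 r0.
  move=> x x0; apply: gen_tail_cvg y01 (cvgr x x0) => j.
  by apply: r0; rewrite addn_gt0 x0.
move=> V1 Vi; do 2 eexists; split; [exact: V1|exact: Vi|].
have bi : beta ^+ i <= 1 by apply: exprn_ile1; lra.
have bp : 0 < beta * p by apply: mulr_gt0; lra.
(* This makes [1 - beta + beta * p * (1 - beta ^+ i)] positive; up to factors [1 - y] and [1 - beta]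
   it is the denominator on either side. *)
have bpi : 0 <= beta * p * (1 - beta ^+ i) by apply: mulr_ge0; lra.
have -> : N = (1 - beta ^+ i) / (1 - beta).
  have := subrX1 beta i; rewrite -/N => bN.
  by apply: (mulIf (_ : 1 - beta != 0)); [|rewrite divfK]; lra.
set b := beta ^+ i in bi bpi *; set D := gen_tail _ _ _.
set S := \sum_(0 <= j < i) _.
field; do ?[apply/andP; split]; lra.
Qed.

(** All ingredients are polynomials in [beta] except the tail series, which is left to Abel's
    theorem; the denominator tends to [1 + i%:R * p], which is positive. *)
Lemma threshold_gap_limit (R : realType) (p : R) i (r : nat -> R) :
  0 < p <= 1 -> (forall x, (0 < x)%N -> 0 <= r x) ->
  cvgn (series (fun j => (1 - p) ^+ j * r (i.+1 + j)%N)) ->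
  ((\sum_(j < i) beta ^+ j) * (1 - beta * (1 - p))
     * gen_tail r (beta * (1 - p)) i.+1
   - \sum_(0 <= j < i) beta ^+ j * r j.+1)
  / (1 + beta * p * (\sum_(j < i) beta ^+ j)) @[beta --> (1 : R)^'-] -->
  (i%:R * p * gen_tail r (1 - p) i.+1 - \sum_(1 <= j < i.+1) r j)
  / (1 + i%:R * p).
Proof.
move=> p01 r0 cvgr.
have q0 : 0 <= 1 - p by lra.
have cvgX j : beta ^+ j @[beta --> (1 : R)^'-] --> (1 : R).
  rewrite -[X in _ --> X](expr1n _ j).
  apply: (@cvg_at_left_filter _ _ (fun b : R => b ^+ j)).
  exact: exprn_continuous.
have cvgI : beta @[beta --> (1 : R)^'-] --> (1 : R) by exact: (cvgX 1%N).
have cvgN : \sum_(j < i) beta ^+ j @[beta --> (1 : R)^'-] --> (i%:R : R).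
  have -> : (i%:R : R) = \sum_(j < i) 1 by rewrite sumr_const card_ord.
  by apply: cvg_big => [|j _]; [exact: add_continuous|exact: cvgX].
have cvgS : \sum_(0 <= j < i) beta ^+ j * r j.+1 @[beta --> (1 : R)^'-] -->
    \sum_(1 <= j < i.+1) r j.
  rewrite big_add1/=.
  under [X in _ --> X]eq_bigr do rewrite -[r _]mul1r.
  by apply: cvg_big => [|j _]; [exact: add_continuous|apply: cvgMl; exact: cvgX].
have cvgtail : gen_tail r (beta * (1 - p)) i.+1 @[beta --> (1 : R)^'-] -->
    gen_tail r (1 - p) i.+1.
  (* Splitting the power of [beta * (1 - p)] leaves a power series in [beta] with coefficients
     [(1 - p) ^+ j * r (i.+1 + j)]. *)
  rewrite /gen_tail; under eq_fun do under eq_fun do rewrite exprMn -mulrA.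
  apply: abel_cvg => // j.
  by rewrite mulr_ge0 ?exprn_ge0 ?r0.
have cvgdenom : 1 + beta * p * (\sum_(j < i) beta ^+ j) @[beta --> (1 : R)^'-] -->
    1 + i%:R * p.
  have -> : 1 + i%:R * p = 1 + 1 * p * i%:R by ring.
  by apply: cvgD; [exact: cvg_cst|apply: cvgM => //; exact: cvgMl].
apply: cvgM; last first.
  apply: cvgV cvgdenom.
  by rewrite gt_eqF// ltr_pwDl// mulr_ge0// ltW//; case/andP: p01.
apply: cvgB => //; apply: cvgM => //; apply: cvgM => //.
rewrite [X in _ --> X](_ : p = 1 - 1 * (1 - p)); last by ring.
by apply: cvgB; [exact: cvg_cst|exact: cvgMl].
Qed.

(** * Summability of the costs and the marginal productivity index *)

(** Multiplied by [q ^+ x], a partial sum is the block from [x] to [x + n - 1] of the given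
    convergent series. *)
Lemma gen_tail_summable (R : realType) (c : nat -> R) (q : R) x :
  0 <= q -> (forall j, (1 <= j)%N -> 0 <= c j) ->
  (\sum_(1 <= j <oo) (c j * q ^+ j)%:E < +oo)%E -> (0 < x)%N ->
  cvgn (series (fun j => q ^+ j * c (x + j)%N)).
Proof.
move=> q0 c0 csum x0; have cx0 j : 0 <= c (x + j)%N by rewrite c0// addn_gt0 x0.
(* Dividing by [q ^+ x] is impossible at [q = 0], but there only the term [j = 0] survives. *)
have [->|qn0] := eqVneq q 0.
  apply: (@cvgP _ _ (c x)); rewrite -cvg_shiftS /=.
  apply: cvg_near_cst; apply: nearW => n.
  rewrite /series /= big_nat_recl//= expr0 mul1r addn0 big1 ?addr0// => j _.
  by rewrite expr0n mul0r.
have q_gt0 : 0 < q by rewrite lt_def qn0.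
pose M := (\sum_(1 <= j <oo) (c j * q ^+ j)%:E)%E.
have cq0 j : (1 <= j)%N -> (0 <= (c j * q ^+ j)%:E)%E.
  by move=> j1; rewrite lee_fin mulr_ge0 ?exprn_ge0 ?c0.
have Mfin : M \is a fin_num.
  by rewrite ge0_fin_numE//; apply: nneseries_ge0 => j j1 _; exact: cq0.
apply: nondecreasing_is_cvgn.
  apply/nondecreasing_seqP => n; rewrite /series /= big_nat_recr//= lerDl.
  by rewrite mulr_ge0 ?exprn_ge0.
exists (fine M / q ^+ x) => _ [n _ <-].
rewrite ler_pdivlMr ?exprn_gt0// -lee_fin fineK//.
apply: (@le_trans _ _ (\sum_(1 <= j < x + n) (c j * q ^+ j)%:E)%E); last first.
  by apply: nneseries_lim_ge => j j1 _; exact: cq0.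
rewrite sumEFin lee_fin (@big_cat_nat _ _ _ x)//= ?leq_addr//.
rewrite -[leLHS]add0r lerD//.
  by rewrite big_nat sumr_ge0// => j /andP[j1 _]; have := cq0 j j1; rewrite lee_fin.
rewrite [leRHS](_ : _ = \sum_(0 + x <= j < n + x) c j * q ^+ j); last first.
  by rewrite add0n addnC.
rewrite big_addn addnK /series /= mulr_suml.
by apply: ler_sum => j _; rewrite [(j + x)%N]addnC exprD mulrAC mulrC [q ^+ x * _]mulrC.
Qed.

(** The sum starting at 1 with exponent [j.-1] is a reindexing. At [q = 0] the series reduces to its
    first term, matching the separate branch of [tail_cost]. *)
Lemma tail_cost_cvg (R : realType) (c : nat -> R) (q : R) i :
  0 <= q -> cvgn (series (fun j => q ^+ j * c (i.+1 + j)%N)) ->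
  (\sum_(1 <= j < n) q ^+ j.-1 * c (i + j)%N) @[n --> \oo]
    --> gen_tail c q i.+1 /\
  tail_cost c i.+1 q = gen_tail c q i.+1.
Proof.
move=> q0 cvgc.
have cvgs : (\sum_(1 <= j < n) q ^+ j.-1 * c (i + j)%N) @[n --> \oo]
    --> gen_tail c q i.+1.
  rewrite -cvg_shiftS /=.
  rewrite [X in X @ _](_ : _ = series (fun j => q ^+ j * c (i.+1 + j)%N))//.
  apply/funext => n; rewrite /series big_add1 /=.
  by apply: eq_bigr => j _; rewrite addnS.
split=> //; rewrite /tail_cost; case: ltP => [_|q_le0]; first exact: cvg_lim.
have {q_le0}q00 : q = 0 by apply/eqP; rewrite eq_le q_le0.
apply/esym/cvg_lim => //; rewrite -cvg_shiftS /=.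
apply: cvg_near_cst; apply: nearW => n.
rewrite /series /= big_nat_recl//= expr0 mul1r addn0 big1 ?addr0// => j _.
by rewrite q00 expr0n mul0r.
Qed.

Lemma mp_index_value (R : realType) (lam mu : R) (d : measure_display)
    (T : measurableType d) (Y : controlled_chain lam mu T) (c : nat -> R) i :
  let p := lam * mu in
  0 < lam <= 1 -> 0 < mu <= 1 -> (0 < i)%N ->
  (forall x, (0 < x)%N -> 0 <= c x) ->
  (forall x, (0 < x)%N ->
    cvgn (series (fun j => (1 - p) ^+ j * c (x + j)%N))) ->
  mp_index_well_defined Y c i /\
  mp_index Y c i =
    mu * (i%:R * p * gen_tail c (1 - p) i.+1 - \sum_(1 <= j < i.+1) c j).
Proof.
move=> p hlam hmu i0 c0 cvgc.
have p_gt0 : 0 < p by rewrite mulr_gt0//; lra.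
have p_le1 : p <= 1 by rewrite mulr_ile1//; lra.
have p01 : 0 < p <= 1 by rewrite p_gt0.
have lam01 : 0 <= lam <= 1 by lra.
have mu01 : 0 <= mu <= 1 by lra.
have q0 : 0 <= 1 - p by lra.
have q1 : `|1 - p| < 1 by rewrite ger0_norm//; lra.
pose r x : R := lam * (i < x)%N%:R.
have r0 x : (0 < x)%N -> 0 <= r x by rewrite mulr_ge0//; lra.
have cvgr x : (0 < x)%N -> cvgn (series (fun j => (1 - p) ^+ j * r (x + j)%N)).
  move=> x0; apply: series_le_cvg (is_cvg_geometric_series (a := lam) q1) => j /=.
  - by rewrite mulr_ge0 ?exprn_ge0 ?r0 ?addn_gt0 ?x0.
  - by rewrite mulr_ge0 ?exprn_ge0//; lra.
  - rewrite mulrC ler_wpM2r ?exprn_ge0// /r.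
    by case: (_ < _)%N; rewrite ?mulr1// mulr0; lra.
have tailr : gen_tail r (1 - p) i.+1 = lam / p.
  rewrite /gen_tail (_ : (fun j => _) = geometric lam (1 - p)).
    by rewrite (cvg_lim _ (@cvg_geometric_series _ lam _ q1))// opprB addrCA subrr addr0.
  by apply/funext => j; rewrite /r addSn ltnS leq_addr mulr1 mulrC.
have headr : \sum_(1 <= j < i.+1) r j = 0.
  by rewrite big_nat big1// => j /andP[_ ji]; rewrite /r ltnNge -ltnS ji mulr0.
pose D (f : nat -> R) (beta : R) : R :=
  ((\sum_(j < i) beta ^+ j) * (1 - beta * (1 - p))
     * gen_tail f (beta * (1 - p)) i.+1
   - \sum_(0 <= j < i) beta ^+ j * f j.+1)
  / (1 + beta * p * (\sum_(j < i) beta ^+ j)).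
have cost beta : 0 < beta < 1 ->
    (forall a, discounted_cost Y c beta (then_threshold R a i) (true, i)
       \is a fin_num) /\
    marginal_cost_disc Y c i i beta = beta * (mu * D c beta).
  move=> b01; have b0 : 0 <= beta by lra.
  have [w1 [w [V1 Vi wE]]] := threshold_value_gap p01 b01 i0 c0 cvgc.
  have E a := @discounted_costE _ _ _ _ _ Y a i i i0 lam01 mu01 c beta w1 w b0 c0 V1 Vi.
  split=> [a|]; first by rewrite E.
  (* The two totals share [c i] and the same [w1], [w]; the reset weight is 0 for one and [mu] for
     the other, so they differ by [beta * mu * (w - w1)]. *)
  by rewrite /marginal_cost_disc !E/= /D -wE; ring.
have work beta : 0 < beta < 1 ->
    (forall a, discounted_work Y beta (then_threshold R a i) (true, i)
       \is a fin_num) /\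
    marginal_work_disc Y i i beta = 1 - beta * (mu * D r beta).
  move=> b01; have b0 : 0 <= beta by lra.
  have [w1 [w [V1 Vi wE]]] := threshold_value_gap p01 b01 i0 r0 cvgr.
  have E a := @discounted_workE _ _ _ _ _ Y a i i i0 lam01 mu01 beta w1 w b0 V1 Vi.
  split=> [a|]; first by rewrite E.
  by rewrite /marginal_work_disc !E/= /D -wE; ring.
have near01 : \forall beta \near (1 : R)^'-, 0 < beta < 1.
  by near=> beta; apply/andP; split; near: beta;
    [exact: nbhs_left_gt|exact: nbhs_left_lt].
have cvgI : beta @[beta --> (1 : R)^'-] --> (1 : R).
  exact: (@cvg_at_left_filter _ _ (fun b : R => b)).
have limc : marginal_cost_disc Y c i i beta @[beta --> (1 : R)^'-] -->
    1 * (mu * ((i%:R * p * gen_tail c (1 - p) i.+1 - \sum_(1 <= j < i.+1) c j)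
      / (1 + i%:R * p))).
  apply: (@cvg_trans _ ((beta * (mu * D c beta)) @[beta --> (1 : R)^'-])).
    apply: near_eq_cvg; near=> beta.
    by have /cost[_ ->] : 0 < beta < 1 by near: beta.
  apply: cvgM => //; apply: cvgMr; apply: threshold_gap_limit => //.
  exact: cvgc.
have limw : marginal_work_disc Y i i beta @[beta --> (1 : R)^'-] -->
    1 - 1 * (mu * ((i%:R * p * (lam / p) - 0) / (1 + i%:R * p))).
  apply: (@cvg_trans _ ((1 - beta * (mu * D r beta)) @[beta --> (1 : R)^'-])).
    apply: near_eq_cvg; near=> beta.
    by have /work[_ ->] : 0 < beta < 1 by near: beta.
  apply: cvgB; first exact: cvg_cst.
  apply: cvgM => //; apply: cvgMr; rewrite -tailr -headr.
  by apply: threshold_gap_limit => //; exact: cvgr.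
have ip0 : 0 <= i%:R * p by rewrite mulr_ge0// ltW.
have workE : marginal_work Y i i = (1 + i%:R * p)^-1.
  rewrite /marginal_work (cvg_lim _ limw)//.
  (* Since [p = lam * mu], the product [mu * (lam / p)] is 1. The resulting [1 + i%:R * p] later
     cancels against the denominator of the marginal cost. *)
  have -> : mu * ((i%:R * p * (lam / p) - 0) / (1 + i%:R * p)) =
      i%:R * p / (1 + i%:R * p).
    by rewrite /p; field; rewrite -/p; repeat (apply/andP; split); lra.
  by field; lra.
split.
  split=> [beta a b01|||].
  - by split; [case: (cost _ b01)|case: (work _ b01)].
  - by apply: cvgP limc.
  - by apply: cvgP limw.
  - by rewrite workE invr_gt0; lra.
rewrite /mp_index workE /marginal_cost (cvg_lim _ limc)//.
by field; lra.
Unshelve. all: by end_near. Qed.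

Theorem lemma13 (R : realType) (lam mu : R)
  (hlam : 0 < lam <= 1) (hmu : 0 < mu <= 1)
  (d : measure_display) (T : measurableType d)
  (Y : controlled_chain lam mu T) (c : nat -> R)
  (p : R) (hp : p = lam * mu) (q : R) (hq : q = 1 - p)
  (c_ge0 : forall i, (1 <= i)%N -> 0 <= c i)
  (c_nondecr : forall i j, (1 <= i)%N -> (i <= j)%N -> c i <= c j)
  (c_summable : (\sum_(1 <= i <oo) (c i * q ^+ i)%:E < +oo)%E)
  (i : nat) (hi : (1 <= i)%N) :
  [/\ mp_index_well_defined Y c i,
      mp_index Y c i
        = mu * (i%:R * p * tail_cost c i.+1 q - \sum_(1 <= j < i.+1) c j),
      0 < q ->
        cvgn (fun n => \sum_(1 <= j < n) q ^+ j.-1 * c (i + j)%N) /\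
        mp_index Y c i
        = mu * (i%:R * p * limn (fun n => \sum_(1 <= j < n)
                                            q ^+ j.-1 * c (i + j)%N)
                - \sum_(1 <= j < i.+1) c j)
    & q = 0 ->
        mp_index Y c i = i%:R * p * c i.+1 - \sum_(1 <= j < i.+1) c j].
Proof.
have p_le1 : lam * mu <= 1 by rewrite mulr_ile1//; lra.
have q0 : 0 <= q by rewrite hq hp; lra.
have cvgc x : (0 < x)%N -> cvgn (series (fun j => q ^+ j * c (x + j)%N)).
  exact: gen_tail_summable.
have [cvgt tailE] := tail_cost_cvg q0 (cvgc i.+1 isT).
move: cvgc; rewrite hq hp => cvgc.
have [wd indexE] := mp_index_value Y hlam hmu hi c_ge0 cvgc.
move: indexE; rewrite -hp -hq => indexE.
split=> //; first by rewrite indexE tailE.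
  move=> q_gt0; split; first by apply: cvgP cvgt.
  by rewrite indexE (cvg_lim _ cvgt).
move=> q00; rewrite indexE -tailE /tail_cost q00 ltxx.
(* With [q = 0] both factors of [p] are forced to be 1, so the prefactor [mu] disappears. *)
have p1 : lam * mu = 1 by lra.
suff -> : mu = 1 by rewrite mul1r.
have : lam * mu <= mu by rewrite ler_piMl//; lra.
by lra.
Qed.
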